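(* Let $(g,h,\omega)$ be a Born structure on a smooth manifold $M$ with recursion operators $A,B,J$, and let $L_\pm$ be the $(\pm1)$-eigenbundles of $A$. Then the signature of $g$ is neutral, and the subbundles $L_\pm$ are null for $g$.
   Context: A Born structure on a smooth manifold $M$ is a triple $(g,h,\omega)$ where $g,h$ are pseudo-Riemannian metrics (of any signature) and $\omega$ is a non-degenerate 2-form such that the endomorphism fields $A,B,J$ of $TM$ (the recursion operators) determined by $g(AX,Y)=\omega(X,Y)$, $g(BX,Y)=h(X,Y)$, $\omega(-JX,Y)=h(X,Y)$ satisfy $A^2=B^2=-J^2=\mathrm{Id}$. Neutral signature means signature $(n,n)$ with $2n=\dim M$. A subbundle $L\subset TM$ is null for $g$ if $g(X,Y)=0$ for all $X,Y\in L$ over the same point. *)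

(* Defs.v *)
From HB Require Import structures.
From mathcomp Require Import all_boot all_order all_algebra.
From mathcomp Require Import all_classical all_reals all_analysis.

Set Implicit Arguments.
Unset Strict Implicit.
Unset Printing Implicit Defensive.

Import Order.TTheory GRing.Theory Num.Theory.
Import numFieldNormedType.Exports.

Local Open Scope classical_set_scope.
Local Open Scope ring_scope.

Section Smooth.
Context {R : realType} {V W : normedModType R}.

(* Only meant for finite-dimensional V and open U, where it is the usual notion:
   f is C^(k+1) iff it is differentiable and its directional derivatives are
   C^k. *)
Fixpoint C_k_on (k : nat) (U : set V) (f : V -> W) : Prop :=
  if k is k'.+1 then
    (forall x, U x -> differentiable f x) /\ (forall v, C_k_on k' U ('D_v f))
  else forall x, U x -> {for x, continuous f}.

Definition smooth_on (U : set V) (f : V -> W) := forall k, C_k_on k U f.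

End Smooth.

Section Jacobian.
Context {R : realType}.

Lemma jacobian_comp (l m n : nat) (f : 'rV[R]_l -> 'rV[R]_m)
    (g : 'rV[R]_m -> 'rV[R]_n) (x : 'rV[R]_l) :
  differentiable f x -> differentiable g (f x) ->
  jacobian (g \o f) x = jacobian f x *m jacobian g (f x).
Proof.
move=> df dg; apply/row_matrixP => a; rewrite !rowE mulmxA.
by rewrite /jacobian !mul_rV_lin1 diff_comp.
Qed.

Lemma near_eq_jacobian (m n : nat) (f g : 'rV[R]_m -> 'rV[R]_n)
    (x : 'rV[R]_m) :
  differentiable f x -> differentiable g x -> (\near x, f x = g x) ->
  jacobian f x = jacobian g x.
Proof.
have row_jacobian (h : 'rV[R]_m -> 'rV[R]_n) a :
    differentiable h x -> row a (jacobian h x) = 'D_(delta_mx 0 a) h x.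
  by move=> dh; rewrite rowE; apply/esym/deriveEjacobian.
move=> df dg fg; apply/row_matrixP => a.
apply: (etrans (row_jacobian f a df)).
apply: (etrans _ (esym (row_jacobian g a dg))).
exact: near_eq_derive.
Qed.

Lemma jacobian_id (m : nat) (x : 'rV[R]_m) :
  jacobian (fun y : 'rV[R]_m => y) x = 1%:M.
Proof.
apply/row_matrixP => a; rewrite !rowE mulmx1.
rewrite -(@deriveEjacobian R m m id x); first exact: derive_id.
exact: ex_diff.
Qed.

End Jacobian.

(* Charts are indexed by [atlas]; chart i is the homeomorphism [cmap i] from the
   open set [cdom i] onto an open subset of R^d, with inverse [cinv i]. Values
   of [cmap i] and [cinv i] outside these sets are irrelevant. The manifold may
   be empty. *)
Record smoothManifold (R : realType) (d : nat) := SmoothManifold {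
  mcarrier :> topologicalType;
  atlas : Type;
  cdom : atlas -> set mcarrier;
  cmap : atlas -> mcarrier -> 'rV[R]_d;
  cinv : atlas -> 'rV[R]_d -> mcarrier;
  mhausdorff : hausdorff_space mcarrier;
  msecond_countable : @second_countable mcarrier;
  cdom_cover : forall p, exists i, cdom i p;
  cdom_open : forall i, open (cdom i);
  cmap_open : forall i, open (cmap i @` cdom i);
  cmapK : forall i p, cdom i p -> cinv i (cmap i p) = p;
  cmap_continuous : forall i, {within cdom i, continuous (cmap i)};
  cinv_continuous : forall i, {within cmap i @` cdom i, continuous (cinv i)};
  transition_smooth : forall i j,
    smooth_on (cmap i @` (cdom i `&` cdom j)) (cmap j \o cinv i)
}.

Section TangentSpace.
Context {R : realType} {d : nat} {M : smoothManifold R d} (p : M).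

Definition chart_at := {i : atlas M | cdom i p}.

Definition transition (i j : atlas M) : 'rV[R]_d -> 'rV[R]_d :=
  cmap j \o cinv i.

(* A tangent vector at p is given by its components in all charts around p,
   related by the Jacobians of the transition maps (acting on row vectors). *)
Definition tangent_family : {pred chart_at -> 'rV[R]_d} := fun v =>
  `[< forall i j : chart_at,
        v j = v i *m jacobian (transition (sval i) (sval j)) (cmap (sval i) p) >].

Lemma tangent_familyP (v : chart_at -> 'rV[R]_d) :
  reflect (forall i j : chart_at,
    v j = v i *m jacobian (transition (sval i) (sval j)) (cmap (sval i) p))
    (v \in tangent_family).
Proof. exact: asboolP. Qed.

Fact tangent_family_submod : submod_closed tangent_family.
Proof.
split=> [|a u v /tangent_familyP hu /tangent_familyP hv]; apply/tangent_familyP.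
  by move=> i j; rewrite mul0mx.
move=> i j; rewrite !fctE/= (hu i j) (hv i j).
by rewrite mulmxDl -scalemxAl.
Qed.

HB.instance Definition _ :=
  GRing.isSubmodClosed.Build R (chart_at -> 'rV[R]_d) tangent_family
    tangent_family_submod.

Record tangent := Tangent {
  components :> chart_at -> 'rV[R]_d;
  componentsP : components \in tangent_family
}.

HB.instance Definition _ := [isSub for components].
HB.instance Definition _ := [Choice of tangent by <:].
HB.instance Definition _ := [SubChoice_isSubLmodule of tangent by <:].

Lemma tangentE (X : tangent) (i j : chart_at) :
  X j = X i *m jacobian (transition (sval i) (sval j)) (cmap (sval i) p).
Proof. by move/tangent_familyP: (componentsP X); apply. Qed.

Lemma cinv_near (i : chart_at) (U : set M) : open U -> U p ->
  \forall x \near cmap (sval i) p, U (cinv (sval i) x).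
Proof.
case: i => i ip /= Uo Up.
have ix : (cmap i @` cdom i) (cmap i p) by exists p.
have := @cinv_continuous _ _ M i.
rewrite continuous_open_subspace; last exact: cmap_open.
move=> /(_ _ (mem_set ix)) /(_ U); apply.
by rewrite /= cmapK//; exact: open_nbhs_nbhs.
Qed.

Lemma transition_near (i j k : chart_at) :
  \forall x \near cmap (sval i) p,
    transition (sval i) (sval k) x =
    (transition (sval j) (sval k) \o transition (sval i) (sval j)) x.
Proof.
have := cinv_near i (@cdom_open _ _ M (sval j)) (svalP j).
by apply: filterS => x xj; rewrite /transition /= cmapK.
Qed.

Lemma transition_id_near (i : chart_at) :
  \forall x \near cmap (sval i) p, transition (sval i) (sval i) x = x.
Proof.
have ix : (cmap (sval i) @` cdom (sval i)) (cmap (sval i) p).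
  by exists p => //; exact: svalP i.
have := open_nbhs_nbhs (conj (@cmap_open _ _ M _) ix).
by apply: filterS => _ [q qi <-]; rewrite /transition /= cmapK.
Qed.

Lemma transition_differentiable (i j : chart_at) :
  differentiable (transition (sval i) (sval j)) (cmap (sval i) p).
Proof.
have [+ _] := @transition_smooth _ _ M (sval i) (sval j) 1%N.
by apply; exists p => //; split; [exact: (svalP i)|exact: (svalP j)].
Qed.

Lemma transition_base (i j : chart_at) :
  transition (sval i) (sval j) (cmap (sval i) p) = cmap (sval j) p.
Proof. by rewrite /transition /= cmapK//; exact: (svalP i). Qed.

Lemma jacobian_transition (i j k : chart_at) :
  jacobian (transition (sval i) (sval k)) (cmap (sval i) p) =
  jacobian (transition (sval i) (sval j)) (cmap (sval i) p) *m
  jacobian (transition (sval j) (sval k)) (cmap (sval j) p).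
Proof.
have dij := transition_differentiable i j.
have djk : differentiable (transition (sval j) (sval k))
    (transition (sval i) (sval j) (cmap (sval i) p)).
  by rewrite transition_base; exact: transition_differentiable.
have -> : cmap (sval j) p = transition (sval i) (sval j) (cmap (sval i) p).
  by rewrite transition_base.
apply: (etrans _ (jacobian_comp dij djk)).
apply: near_eq_jacobian; first exact: transition_differentiable.
  exact: differentiable_comp.
exact: transition_near.
Qed.

Lemma jacobian_transition_id (i : chart_at) :
  jacobian (transition (sval i) (sval i)) (cmap (sval i) p) = 1%:M.
Proof.
apply: (etrans _ (jacobian_id (cmap (sval i) p))).
apply: near_eq_jacobian; [exact: transition_differentiable|by []|].
exact: transition_id_near.
Qed.

Definition base_chart : chart_at := cid (@cdom_cover _ _ M p).

(* The components in one chart at p determine a tangent vector, and are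
   arbitrary. *)
Fact tangent_vect_iso : Vector.axiom d tangent.
Proof.
exists (fun X : tangent => X base_chart); first by [].
pose f (u : 'rV[R]_d) (j : chart_at) := u *m
  jacobian (transition (sval base_chart) (sval j)) (cmap (sval base_chart) p).
have fP u : f u \in tangent_family.
  apply/tangent_familyP => i j.
  by rewrite /f (jacobian_transition _ i) mulmxA.
exists (fun u => Tangent (fP u)) => [X|u].
  by apply/val_inj/funext => j /=; rewrite /f -tangentE.
by rewrite /= /f jacobian_transition_id mulmx1.
Qed.

HB.instance Definition _ :=
  Lmodule_hasFinDim.Build R tangent tangent_vect_iso.

End TangentSpace.
Arguments tangent {R d M} p.
Arguments chart_at {R d M} p.

Lemma dim_tangent (R : realType) (d : nat) (M : smoothManifold R d) (p : M) :
  \dim {: tangent p} = d.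
Proof. exact: dimvf. Qed.

Section Tensors.
Context {R : realType} {d : nat} {M : smoothManifold R d}.

(* In each chart, b = \sum_(a, c) G a c dx^a (x) dx^c with smooth G. *)
Definition smooth_form (b : forall p : M, tangent p -> tangent p -> R) :=
  forall i : atlas M, exists2 G : 'rV[R]_d -> 'M[R]_d,
    smooth_on (cmap i @` cdom i) G &
    forall (p : M) (ip : cdom i p) (X Y : tangent p),
      let j : chart_at p := exist _ i ip in
      b p X Y = (X j *m G (cmap i p) *m (Y j)^T) 0 0.

Definition pseudo_riemannian (g : forall p : M, {symmetric (tangent p)}) :=
  smooth_form (fun p => g p) /\ forall p, nondegenerate (g p).

Definition nondegenerate_two_form
    (w : forall p : M, {skew_symmetric (tangent p)}) :=
  smooth_form (fun p => w p) /\ forall p, nondegenerate (w p).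

(* Non-degeneracy of g and w makes A, B and J unique, and smooth. *)
Definition recursion_operators
    (g h : forall p : M, {symmetric (tangent p)})
    (w : forall p : M, {skew_symmetric (tangent p)})
    (A B J : forall p : M, 'End(tangent p)) :=
  forall p (X Y : tangent p),
    [/\ g p (A p X) Y = w p X Y,
        g p (B p X) Y = h p X Y &
        w p (- J p X) Y = h p X Y].

Definition born_structure
    (g h : forall p : M, {symmetric (tangent p)})
    (w : forall p : M, {skew_symmetric (tangent p)}) :=
  [/\ pseudo_riemannian g, pseudo_riemannian h, nondegenerate_two_form w &
    exists A B J : forall p : M, 'End(tangent p),
      recursion_operators g h w A B J /\
      forall p, [/\ (A p \o A p)%VF = \1%VF,
                    (B p \o B p)%VF = \1%VF &
                    (- (J p \o J p))%VF = \1%VF]].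

Definition eigenbundle (A : forall p : M, 'End(tangent p)) (a : R) (p : M) :
  {vspace tangent p} := passmx.leigenspace (A p) a.

Definition null_for (g : forall p : M, {symmetric (tangent p)})
    (L : forall p : M, {vspace tangent p}) :=
  forall p, {in L p &, forall X Y, g p X Y = 0}.

End Tensors.

(* The form b has an orthonormal basis with r vectors of square 1 followed by
   s vectors of square -1. *)
Definition has_signature (R : realType) (V : vectType R) (b : V -> V -> R)
    (r s : nat) :=
  exists2 e : (r + s).-tuple V, basis_of fullv e &
    forall i j : 'I_(r + s),
      b (tnth e i) (tnth e j) = if i == j then (-1) ^+ (r <= i)%N else 0.

(* d is the dimension of M; stated pointwise so that an empty M
   is neutral whatever d. *)
Definition neutral_signature (R : realType) (d : nat) (M : smoothManifold R d)
    (g : forall p : M, {symmetric (tangent p)}) :=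
  forall p : M, exists2 n : nat, d = (2 * n)%N & has_signature (g p) n n.

(* Main.v *)
From HB Require Import structures.
Require Import Defs.
From mathcomp Require Import all_boot all_order all_algebra.
From mathcomp Require Import all_classical all_reals all_analysis.
From mathcomp Require Import ring.

Local Open Scope ring_scope.

Import GRing.Theory Num.Theory.

(** The statement is linear algebra in each tangent space. There g (A X) Y =
    w X Y with g symmetric and w skew, so A is skew-adjoint for g: if
    A X = a X and A Y = a Y then a g(X, Y) = w(X, Y) is both symmetric and
    skew in X, Y, hence zero. As a = 1 or a = -1 is invertible,
    both eigenspaces L+ and L- of A are null. Since A is an involution, they
    span the tangent space.

    Neutrality of g holds for any nondegenerate symmetric form b on a space
    spanned by two null subspaces L1 and L2 ([null_pair_neutral]). A vector of
    L2 that is orthogonal to L1 is orthogonal to everything, so it vanishes: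
    b pairs L1 and L2 perfectly. Hence L1 and L2 are complementary, have the
    same dimension n, and a basis x_i of L1 has a dual family y_i in L2 with
    b(x_i, y_j) = 1/2 if i = j and 0 otherwise. The vectors x_i + y_i and
    x_i - y_i are then orthonormal, with squares 1 and -1 respectively.

    The definition of a Born structure provides some operator A with A^2 = Id,
    and nondegeneracy of g identifies it with the given one. *)

(** * Complementary null subspaces *)

Section NullPair.
Context {F : fieldType} {V : vectType F} {b : {symmetric V}}.
Implicit Types (L : {vspace V}) (X Y : V).

Lemma symmetric_formC X Y : b X Y = b Y X.
Proof. by rewrite hermC expr0 mul1r. Qed.

Lemma nondegenerate_eq0 X :
  nondegenerate b -> (forall Y, b X Y = 0) -> X = 0.
Proof.
move=> /eqP b0 X0; apply/eqP; rewrite -memv0 -b0.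
by apply/mem_orthovP => Y _.
Qed.

Definition null_subspace L := {in L &, forall X Y, b X Y = 0}.

(** Y is orthogonal to L1 by assumption and to L2 because L2 is null. *)
Lemma null_pair_orthogonal_eq0 {L1 L2} Y : nondegenerate b ->
  null_subspace L2 -> (L1 + L2)%VS = fullv ->
  Y \in L2 -> {in L1, forall X, b X Y = 0} -> Y = 0.
Proof.
move=> b0 null2 L12 Y2 Y1; apply: nondegenerate_eq0 => // Z.
have /memv_addP[X X1 [X' X'2 ->]] : Z \in (L1 + L2)%VS by rewrite L12 memvf.
by rewrite linearDr /= (null2 Y X') // symmetric_formC Y1 // addr0.
Qed.

Lemma null_pair_disjoint {L1 L2} : nondegenerate b ->
  null_subspace L1 -> null_subspace L2 -> (L1 + L2)%VS = fullv ->
  (L1 :&: L2)%VS = 0%VS.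
Proof.
move=> b0 null1 null2 L12; apply/eqP; rewrite -subv0; apply/subvP => Y.
rewrite memv_cap memv0 => /andP[Y1 Y2]; apply/eqP.
by apply: (null_pair_orthogonal_eq0 Y b0 null2 L12 Y2) => X X1; apply: null1.
Qed.

(** The coordinates of the linear form that Y induces on L, in the dual of
    the basis [vbasis L]. *)
Definition pairing_row L Y : 'rV[F]_(\dim L) := \row_i b (vbasis L)`_i Y.

Fact pairing_row_linear L : linear (pairing_row L).
Proof. by move=> a X Y; apply/rowP => i; rewrite !mxE linearPr. Qed.
HB.instance Definition _ L :=
  GRing.isLinear.Build F V 'rV[F]_(\dim L) _ (pairing_row L)
    (pairing_row_linear L).

(** Only zero in L2 is orthogonal to the whole basis of L1, so the pairing is
    injective on L2. *)
Lemma dim_pairing_row {L1 L2} : nondegenerate b ->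
  null_subspace L2 -> (L1 + L2)%VS = fullv ->
  \dim (linfun (pairing_row L1) @: L2) = \dim L2.
Proof.
move=> b0 null2 L12; apply: limg_dim_eq; apply/eqP; rewrite -subv0.
apply/subvP => Y; rewrite memv_cap memv_ker lfunE memv0 => /andP[Y2 /eqP Y0].
apply/eqP/(null_pair_orthogonal_eq0 Y b0 null2 L12 Y2) => X /coord_vbasis ->.
rewrite linear_sumlz big1 // => i _; rewrite linearZl_LR /=.
by have /rowP/(_ i) := Y0; rewrite !mxE => ->; rewrite mulr0.
Qed.

Lemma null_pair_dim_le {L1 L2} : nondegenerate b ->
  null_subspace L2 -> (L1 + L2)%VS = fullv -> (\dim L2 <= \dim L1)%N.
Proof.
move=> b0 null2 L12; rewrite -(dim_pairing_row b0 null2 L12).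
by apply: leq_trans (dimvS (subvf _)) _; rewrite dimvf /dim /= mul1n.
Qed.

Lemma null_pair_dim_eq {L1 L2} : nondegenerate b ->
  null_subspace L1 -> null_subspace L2 -> (L1 + L2)%VS = fullv ->
  \dim L2 = \dim L1.
Proof.
move=> b0 null1 null2 L12; apply/eqP.
by rewrite eqn_leq !null_pair_dim_le // addvC.
Qed.

Lemma null_pair_dim {L1 L2} : nondegenerate b ->
  null_subspace L1 -> null_subspace L2 -> (L1 + L2)%VS = fullv ->
  \dim {: V} = (\dim L1 + \dim L1)%N.
Proof.
move=> b0 null1 null2 L12; rewrite -L12.
rewrite (dimv_disjoint_sum (null_pair_disjoint b0 null1 null2 L12)).
by rewrite (null_pair_dim_eq b0 null1 null2 L12).
Qed.

(** In matching dimensions the perfect pairing becomes surjective: any values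
    on a basis of L1 are those of a vector of L2. *)
Lemma null_pair_dual {L1 L2} (c : 'I_(\dim L1) -> F) : nondegenerate b ->
  null_subspace L1 -> null_subspace L2 -> (L1 + L2)%VS = fullv ->
  exists2 Y, Y \in L2 & forall i : 'I_(\dim L1), b (vbasis L1)`_i Y = c i.
Proof.
move=> b0 null1 null2 L12.
have full : (linfun (pairing_row L1) @: L2)%VS = fullv.
  apply/eqP; rewrite eqEdim subvf dim_pairing_row //.
  by rewrite (null_pair_dim_eq b0 null1 null2 L12) dimvf /dim /= mul1n.
have /memv_imgP[Y Y2 cY] : \row_i c i \in (linfun (pairing_row L1) @: L2)%VS.
  by rewrite full memvf.
exists Y => // i; move/rowP/(_ i): cY.
by rewrite lfunE !mxE => ->.
Qed.

End NullPair.
Arguments null_subspace {F V} b L.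

(** * Signature *)

Section Signature.
Context {R : realType} {V : vectType R} {b : {symmetric V}}.

(** An orthonormal family is free, so that counting its members suffices. *)
Lemma orthonormal_has_signature r s (e : (r + s).-tuple V) :
  \dim {: V} = (r + s)%N ->
  (forall i j : 'I_(r + s),
     b (tnth e i) (tnth e j) = if i == j then (-1) ^+ (r <= i)%N else 0) ->
  has_signature b r s.
Proof.
move=> dV be; exists e => //; rewrite basisEfree subvf size_tuple dV leqnn !andbT.
apply/freeP => k k0 i.
have : b (\sum_(j < r + s) k j *: e`_j) (tnth e i) = 0 by rewrite k0 linear0l.
rewrite linear_sumlz /= (bigD1 i) //= big1 => [|j ji].
  rewrite linearZl_LR /= -tnth_nth be eqxx addr0 => /eqP.
  by rewrite mulf_eq0 signr_eq0 orbF => /eqP.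
by rewrite linearZl_LR /= -tnth_nth be (negPf ji) mulr0.
Qed.

(** The pairing value 1/2 between dual vectors x_i and y_i gives x_i + y_i and
    x_i - y_i the squares 2 * 1/2 and - 2 * 1/2, and the two cross terms of
    b(x_i + y_i, x_j - y_j) cancel. *)
Lemma null_pair_neutral (L1 L2 : {vspace V}) : nondegenerate b ->
  null_subspace b L1 -> null_subspace b L2 -> (L1 + L2)%VS = fullv ->
  has_signature b (\dim L1) (\dim L1).
Proof.
move=> b0 null1 null2 L12; set n := \dim L1.
pose x (i : 'I_n) := (vbasis L1)`_i.
have x1 i : x i \in L1 by rewrite vbasis_mem // mem_nth // size_tuple.
have /boolp.choice[y yP] (j : 'I_n) : exists Y, Y \in L2 /\
    forall i, b (x i) Y = if i == j then 2^-1 else 0.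
  have [Y Y2 YP] := null_pair_dual (fun i => if i == j then 2^-1 else 0)
    b0 null1 null2 L12.
  by exists Y.
have bxy i j : b (x i) (y j) = if i == j then 2^-1 else 0 by apply: (yP j).2.
have bxx i j : b (x i) (x j) = 0 by apply: null1.
have byy i j : b (y i) (y j) = 0 by apply: null2; apply: (yP _).1.
have byx i j : b (y i) (x j) = if i == j then 2^-1 else 0.
  by rewrite symmetric_formC bxy eq_sym.
apply: (@orthonormal_has_signature _ _
  [tuple of [tuple x i + y i | i < n] ++ [tuple x i - y i | i < n]]).
  exact: null_pair_dim b0 null1 null2 L12.
move=> i j; rewrite -(fintype.splitK i) -(fintype.splitK j).
case: (fintype.split i) => {}i; case: (fintype.split j) => {}j /=;
  rewrite ?tnth_lshift ?tnth_rshift !tnth_mktuple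
    ?(linearDl, linearDr, linearNl, linearNr) /= bxx byy bxy byx
    ?eq_lshift ?eq_rshift ?eq_lrshift ?eq_rlshift /=.
- by rewrite leqNgt ltn_ord; case: eqP => _; field.
- by case: eqP => _; ring.
- by case: eqP => _; ring.
- by rewrite leq_addr; case: eqP => _; field.
Qed.

End Signature.

(** * Eigenspaces *)

Section Eigenspaces.
Context {F : fieldType} {V : vectType F}.
Implicit Types (A : 'End(V)) (X Y : V).

Lemma mem_leigenspace A a X :
  (X \in passmx.leigenspace A a) = (A X == a *: X).
Proof.
by rewrite memv_ker add_lfunE opp_lfunE scale_lfunE id_lfunE subr_eq0.
Qed.

(** X is the sum of its components (X + A X) / 2 and (X - A X) / 2. *)
Lemma involution_leigenspaces A : 2 != 0 :> F -> (A \o A)%VF = \1%VF ->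
  (passmx.leigenspace A 1 + passmx.leigenspace A (-1))%VS = fullv.
Proof.
move=> two0 A2; apply/eqP; rewrite eqEsubv subvf /=; apply/subvP => X _.
have AA : A (A X) = X by rewrite -comp_lfunE A2 id_lfunE.
apply/memv_addP; exists (2^-1 *: (X + A X)).
  by rewrite mem_leigenspace linearZ linearD /= AA scale1r addrC.
exists (2^-1 *: (X - A X)).
  by rewrite mem_leigenspace linearZ linearB /= AA scaleN1r -scalerN opprB.
rewrite -scalerDr addrACA subrr addr0 -mulr2n -scaler_nat scalerA.
by rewrite mulVf // scale1r.
Qed.

(** On the eigenspace, a * g is the restriction of w, so it is both symmetric
    and skew. *)
Lemma recursion_leigenspace_null {g : {symmetric V}} {w : {skew_symmetric V}}
    A a : 2 != 0 :> F -> a != 0 -> (forall X Y, g (A X) Y = w X Y) ->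
  null_subspace g (passmx.leigenspace A a).
Proof.
move=> two0 a0 gAw X Y; rewrite !mem_leigenspace => /eqP AX /eqP AY.
have wX : w X Y = a * g X Y by rewrite -gAw AX linearZl_LR /=.
have wY : w Y X = a * g X Y by rewrite -gAw AY linearZl_LR /= symmetric_formC.
have /eqP : a * g X Y = - (a * g X Y).
  by rewrite -{1}wX hermC wY expr1 mulN1r.
rewrite -addr_eq0 -mulr2n -mulr_natl mulf_eq0 (negPf two0) mulf_eq0 (negPf a0).
by move=> /eqP.
Qed.

End Eigenspaces.

(** * Born structures *)

Theorem corollary13 (R : realType) (d : nat) (M : smoothManifold R d)
    (g h : forall p : M, {symmetric (tangent p)})
    (w : forall p : M, {skew_symmetric (tangent p)})
    (A B J : forall p : M, 'End(tangent p)) :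
  born_structure g h w ->
  recursion_operators g h w A B J ->
  [/\ neutral_signature g,
      null_for g (eigenbundle A 1) &
      null_for g (eigenbundle A (-1))].
Proof.
move=> [[_ g0] _ _ [A' [B' [J' [rec' inv']]]]] rec.
have two0 : 2 != 0 :> R by rewrite pnatr_eq0.
have gAw p X Y : g p (A p X) Y = w p X Y by case: (rec p X Y).
(* Nondegeneracy of g makes the recursion operator unique. *)
have AA' p : A p = A' p.
  apply/lfunP => X; apply/eqP; rewrite -subr_eq0; apply/eqP.
  apply: (nondegenerate_eq0 _ (g0 p)) => Y; rewrite linearBl /= gAw.
  by case: (rec' p X Y) => -> _ _; rewrite subrr.
have null a p : a != 0 -> null_subspace (g p) (eigenbundle A a p).
  by move=> a0; apply: recursion_leigenspace_null (gAw p).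
have nullp p : null_subspace (g p) (eigenbundle A 1 p).
  by apply: null; rewrite oner_eq0.
have nullm p : null_subspace (g p) (eigenbundle A (-1) p).
  by apply: null; rewrite oppr_eq0 oner_eq0.
split; [move=> p | exact: nullp | exact: nullm].
have span : (eigenbundle A 1 p + eigenbundle A (-1) p)%VS = fullv.
  by apply: involution_leigenspaces two0 _; rewrite AA'; case: (inv' p).
exists (\dim (eigenbundle A 1 p)).
  rewrite mul2n -addnn; apply: etrans (esym (dim_tangent p)) _.
  exact: null_pair_dim (g0 p) (nullp p) (nullm p) span.
exact: null_pair_neutral (g0 p) (nullp p) (nullm p) span.
Qed.
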